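(* Let $K$ be a field and let $A=KQ/I$ be an indecomposable finite dimensional $K$-algebra with $I$ an admissible ideal in the path algebra $KQ$ of a quiver $Q$. If $A$ is self-injective and $\operatorname{rad}^2(A)\neq 0$, then the socle of $A$ is arrow-free.
   Context: For $A=KQ/I$ with canonical surjection $\pi\colon KQ\to A$, write $\bar a=\pi(a)$ for an arrow $a\in Q_1$. The socle of $A$ is called arrow-free if, for each arrow $a\in Q_1$, $\bar a\notin\operatorname{soc}({}_AA)$ and $\bar a\notin\operatorname{soc}(A_A)$, where ${}_AA$ denotes $A$ as a left module and $A_A$ denotes $A$ as a right module. *)

(* Defs.v *)
From HB Require Import structures.
From mathcomp Require Import all_boot all_algebra.
From mathcomp Require Import finmap monalg.
From mathcomp Require Import boolp classical_sets.

Set Implicit Arguments.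
Unset Strict Implicit.
Unset Printing Implicit Defensive.

Import GRing.Theory.

Local Open Scope classical_set_scope.
Local Open Scope ring_scope.

(* Modules over a ring.  Left modules over R are lmodTypes over R; right       *)
(* modules are left modules over the converse ring R^c.  In particular the     *)
(* regular modules of A are A^o (left) and A^c^o (right), all convertible to A.*)

Section Modules.
Variables (R : nzRingType) (M : lmodType R).

Definition submodule (N : set M) : Prop :=
  N 0 /\ forall (a : R) x y, N x -> N y -> N (a *: x + y).

Definition simple_submodule (S : set M) : Prop :=
  [/\ submodule S, S <> [set 0] &
      forall N, submodule N -> N `<=` S -> N = [set 0] \/ N = S].

Definition maximal_submodule (S : set M) : Prop :=
  [/\ submodule S, S <> setT &
      forall N, submodule N -> S `<=` N -> N = S \/ N = setT].

(* The sum of all simple submodules. *)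
Definition socle : set M :=
  [set x | exists2 s : seq M,
     forall y, y \in s -> exists2 S, simple_submodule S & S y
   & x = \sum_(y <- s) y].

Definition module_radical : set M :=
  \bigcap_(S in maximal_submodule) S.

Definition injective_module : Prop :=
  forall (X Y : lmodType R) (f : {linear X -> Y}) (g : {linear X -> M}),
    injective f -> exists h : {linear Y -> M}, forall x, h (f x) = g x.

End Modules.

Arguments socle {R} M.
Arguments module_radical {R} M.
Arguments injective_module {R} M.

Definition left_socle (A : nzRingType) : set A := socle A^o.
Definition right_socle (A : nzRingType) : set A := socle (A^c)^o.
Definition jacobson_radical (A : nzRingType) : set A := module_radical A^o.

Arguments left_socle A : clear implicits.
Arguments right_socle A : clear implicits.
Arguments jacobson_radical A : clear implicits.

Definition self_injective (A : nzRingType) : Prop := injective_module A^o.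

Section Ideals.
Variable A : nzRingType.

Record is_ideal (I : set A) : Prop := IsIdeal {
  ideal0 : I 0;
  idealD : forall x y, I x -> I y -> I (x + y);
  idealMl : forall a x, I x -> I (a * x);
  idealMr : forall a x, I x -> I (x * a)
}.

Definition ideal_generated (X : set A) : set A :=
  \bigcap_(J in [set J | is_ideal J /\ X `<=` J]) J.

Definition ideal_mul (I J : set A) : set A :=
  [set z | exists2 s : seq (A * A),
     forall p, p \in s -> I p.1 /\ J p.2
   & z = \sum_(p <- s) p.1 * p.2].

Definition ideal_exp (I : set A) (n : nat) : set A :=
  iter n (ideal_mul I) setT.

(* Algebras of type algType are nonzero, so quotients are taken by proper      *)
(* ideals only.                                                                *)
Record proper_twosided_ideal := ProperIdeal {
  ideal_set :> set A;
  ideal_setP : is_ideal ideal_set;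
  ideal_proper : ~ ideal_set 1
}.

End Ideals.

Section Quotient.
Variables (K : fieldType) (A : algType K) (I : proper_twosided_ideal A).

Local Open Scope quotient_scope.

Lemma proper_ideal0 : ideal_set I 0. Proof. exact: ideal0 (ideal_setP I). Qed.

Lemma proper_idealD x y : ideal_set I x -> ideal_set I y -> ideal_set I (x + y).
Proof. exact: idealD (ideal_setP I) _ _. Qed.

Lemma proper_idealMl a x : ideal_set I x -> ideal_set I (a * x).
Proof. exact: idealMl (ideal_setP I) _ _. Qed.

Lemma proper_idealMr a x : ideal_set I x -> ideal_set I (x * a).
Proof. exact: idealMr (ideal_setP I) _ _. Qed.

Lemma proper_idealN x : ideal_set I x -> ideal_set I (- x).
Proof. by rewrite -mulN1r; exact: proper_idealMl. Qed.

Lemma proper_idealZ (k : K) x : ideal_set I x -> ideal_set I (k *: x).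
Proof. by rewrite -[x in _ *: x]mul1r scalerAl; exact: proper_idealMl. Qed.

Definition ideal_eq (x y : A) : bool := `[< ideal_set I (x - y) >].

Lemma ideal_eq_refl : reflexive ideal_eq.
Proof. by move=> x; apply/asboolP; rewrite subrr; exact: proper_ideal0. Qed.

Lemma ideal_eq_sym : symmetric ideal_eq.
Proof.
by move=> x y; apply/asboolP/asboolP => /proper_idealN; rewrite opprB.
Qed.

Lemma ideal_eq_trans : transitive ideal_eq.
Proof.
move=> y x z /asboolP xy /asboolP yz; apply/asboolP.
by rewrite -[x](subrK y) -addrA; exact: proper_idealD.
Qed.

Canonical ideal_equiv :=
  EquivRel ideal_eq ideal_eq_refl ideal_eq_sym ideal_eq_trans.

Definition quotient_algebra : Type := {eq_quot ideal_equiv}.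

HB.instance Definition _ := Choice.on quotient_algebra.
HB.instance Definition _ := EqQuotient.on quotient_algebra.

Definition quotient_map (x : A) : quotient_algebra := \pi_quotient_algebra x.

Lemma quotient_map_eq x y : quotient_map x = quotient_map y <-> ideal_set I (x - y).
Proof.
split=> [/eqP|H]; first by rewrite eqmodE => /asboolP.
by apply/eqP; rewrite eqmodE; apply/asboolP.
Qed.

Lemma quotient_map_surj y : exists x, quotient_map x = y.
Proof. by exists (repr y); exact: reprK. Qed.

Let q_zero : quotient_algebra := quotient_map 0.
Let q_one : quotient_algebra := quotient_map 1.
Let q_opp (x : quotient_algebra) := quotient_map (- repr x).
Let q_add (x y : quotient_algebra) := quotient_map (repr x + repr y).
Let q_mul (x y : quotient_algebra) := quotient_map (repr x * repr y).
Let q_scale (k : K) (x : quotient_algebra) := quotient_map (k *: repr x).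

Let repr_map x : ideal_set I (repr (quotient_map x) - x).
Proof. by apply/quotient_map_eq; exact: reprK. Qed.

Let q_oppE x : q_opp (quotient_map x) = quotient_map (- x).
Proof.
by apply/quotient_map_eq; rewrite -opprD; apply: proper_idealN.
Qed.

Let q_addE x y :
  q_add (quotient_map x) (quotient_map y) = quotient_map (x + y).
Proof.
by apply/quotient_map_eq; rewrite opprD addrACA; apply: proper_idealD.
Qed.

Let q_mulE x y :
  q_mul (quotient_map x) (quotient_map y) = quotient_map (x * y).
Proof.
apply/quotient_map_eq.
rewrite -[X in ideal_set I X](subrKA (x * repr (quotient_map y))) -mulrBl -mulrBr.
by apply: proper_idealD; [exact: proper_idealMr | exact: proper_idealMl].
Qed.

Let q_scaleE k x : q_scale k (quotient_map x) = quotient_map (k *: x).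
Proof. by apply/quotient_map_eq; rewrite -scalerBr; apply: proper_idealZ. Qed.

Let q_ind (P : quotient_algebra -> Prop) :
  (forall x, P (quotient_map x)) -> forall y, P y.
Proof. by move=> H y; have [x <-] := quotient_map_surj y. Qed.

Let q_addA : associative q_add.
Proof. by do 3!elim/q_ind => ?; rewrite !q_addE addrA. Qed.
Let q_addC : commutative q_add.
Proof. by do 2!elim/q_ind => ?; rewrite !q_addE addrC. Qed.
Let q_add0 : left_id q_zero q_add.
Proof. by elim/q_ind => ?; rewrite q_addE add0r. Qed.
Let q_addN : left_inverse q_zero q_opp q_add.
Proof. by elim/q_ind => ?; rewrite q_oppE q_addE addNr. Qed.

HB.instance Definition _ :=
  GRing.isZmodule.Build quotient_algebra q_addA q_addC q_add0 q_addN.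

Let q_mulA : associative q_mul.
Proof. by do 3!elim/q_ind => ?; rewrite !q_mulE mulrA. Qed.
Let q_mul1l : left_id q_one q_mul.
Proof. by elim/q_ind => ?; rewrite q_mulE mul1r. Qed.
Let q_mul1r : right_id q_one q_mul.
Proof. by elim/q_ind => ?; rewrite q_mulE mulr1. Qed.
Let q_mulDl : left_distributive q_mul q_add.
Proof. by do 3!elim/q_ind => ?; rewrite !(q_addE, q_mulE) mulrDl. Qed.
Let q_mulDr : right_distributive q_mul q_add.
Proof. by do 3!elim/q_ind => ?; rewrite !(q_addE, q_mulE) mulrDr. Qed.
Let q_one_neq0 : q_one != 0 :> quotient_algebra.
Proof.
apply/eqP => /quotient_map_eq; rewrite subr0; exact: ideal_proper.
Qed.

HB.instance Definition _ := GRing.Zmodule_isNzRing.Build quotient_algebra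
  q_mulA q_mul1l q_mul1r q_mulDl q_mulDr q_one_neq0.

Let q_scaleA a b v : q_scale a (q_scale b v) = q_scale (a * b) v.
Proof. by elim/q_ind: v => ?; rewrite !q_scaleE scalerA. Qed.
Let q_scale1 : left_id 1 q_scale.
Proof. by elim/q_ind => ?; rewrite q_scaleE scale1r. Qed.
Let q_scaleDr : right_distributive q_scale q_add.
Proof.
by move=> k; do 2!elim/q_ind => ?; rewrite !(q_addE, q_scaleE) scalerDr.
Qed.
Let q_scaleDl v : {morph q_scale^~ v : a b / a + b >-> q_add a b}.
Proof.
by move=> a b /=; elim/q_ind: v => ?; rewrite !(q_addE, q_scaleE) scalerDl.
Qed.

HB.instance Definition _ := GRing.Zmodule_isLmodule.Build K quotient_algebra
  q_scaleA q_scale1 q_scaleDr q_scaleDl.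

Let q_scaleAl a u v : q_scale a (q_mul u v) = q_mul (q_scale a u) v.
Proof.
by elim/q_ind: u => u; elim/q_ind: v => v; rewrite !(q_mulE, q_scaleE) scalerAl.
Qed.

HB.instance Definition _ :=
  GRing.Lmodule_isLalgebra.Build K quotient_algebra q_scaleAl.

Let q_scaleAr a u v : q_scale a (q_mul u v) = q_mul u (q_scale a v).
Proof.
by elim/q_ind: u => u; elim/q_ind: v => v; rewrite !(q_mulE, q_scaleE) scalerAr.
Qed.

HB.instance Definition _ :=
  GRing.Lalgebra_isAlgebra.Build K quotient_algebra q_scaleAr.

Lemma quotient_map_linear : linear quotient_map.
Proof. by move=> a x y; rewrite -q_addE -q_scaleE. Qed.

HB.instance Definition _ :=
  GRing.isLinear.Build K A quotient_algebra _ quotient_map quotient_map_linear.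

Lemma quotient_map_monoid : monoid_morphism quotient_map.
Proof. by split=> // x y; rewrite -q_mulE. Qed.

HB.instance Definition _ := GRing.isMonoidMorphism.Build A quotient_algebra
  quotient_map quotient_map_monoid.

End Quotient.

Section Algebras.
Variables (K : fieldType) (A : algType K).

Definition finite_dimensional : Prop :=
  exists n (b : 'I_n -> A),
    forall x, exists c : 'I_n -> K, x = \sum_i c i *: b i.

(* Nonzeroness of A, B and C is part of algType. *)
Definition indecomposable_algebra : Prop :=
  ~ exists (B C : algType K) (f : {lrmorphism A -> (B * C)%type}), bijective f.

End Algebras.

Arguments finite_dimensional {K} A.
Arguments indecomposable_algebra {K} A.

(* Nonemptiness makes path algebras nonzero, as required by algType. *)
Record quiver := Quiver {
  vertex : finType;
  arrow : finType;
  source : arrow -> vertex;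
  target : arrow -> vertex;
  quiver_nonempty : (0 < #|vertex|)%N
}.

Section Paths.
Variable Q : quiver.

Fixpoint composable (x : vertex Q) (s : seq (arrow Q)) : bool :=
  if s is a :: s' then (source a == x) && composable (target a) s' else true.

(* A path is a start vertex together with its arrows in order of traversal;    *)
(* the start vertex is needed for the trivial paths.                           *)
Record qpath := QPath {
  qpath_val : vertex Q * seq (arrow Q);
  _ : composable qpath_val.1 qpath_val.2
}.

HB.instance Definition _ := [isSub for qpath_val].
HB.instance Definition _ := [Choice of qpath by <:].

Definition path_start (p : qpath) : vertex Q := (val p).1.
Definition path_arrows (p : qpath) : seq (arrow Q) := (val p).2.
Definition path_end (p : qpath) : vertex Q :=
  last (path_start p) (map (@target Q) (path_arrows p)).

Definition trivial_path (x : vertex Q) : qpath := @QPath (x, [::]) isT.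

Lemma arrow_pathP (a : arrow Q) : composable (source a) [:: a].
Proof. by rewrite /= eqxx. Qed.
Definition arrow_path (a : arrow Q) : qpath := @QPath (_, _) (arrow_pathP a).

Lemma composable_cat x s t :
  composable x (s ++ t) =
  composable x s && composable (last x (map (@target Q) s)) t.
Proof. by elim: s x => //= a s IHs x; rewrite IHs andbA. Qed.

Lemma path_catP (p q : qpath) : path_end p = path_start q ->
  composable (path_start p) (path_arrows p ++ path_arrows q).
Proof.
case: p q => [[x s] Hs] [[y t] Ht]; rewrite /path_end /= => e.
by rewrite composable_cat Hs /path_start /path_arrows /= e.
Qed.

(* First p, then q. *)
Definition path_cat (p q : qpath) : option qpath :=
  if @eqP _ (path_end p) (path_start q) is ReflectT e
  then Some (@QPath (_, _) (path_catP e)) else None.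

Lemma path_cat_some p q r : path_cat p q = Some r <->
  path_end p = path_start q /\
  val r = (path_start p, path_arrows p ++ path_arrows q).
Proof.
rewrite /path_cat; case: eqP => e; split=> //; last by case.
- by case=> <-.
- by case=> _ er; congr Some; apply/val_inj.
Qed.

Lemma path_cat_none p q :
  path_cat p q = None <-> path_end p <> path_start q.
Proof. by rewrite /path_cat; case: eqP. Qed.

Lemma path_end_cat p q r : path_cat p q = Some r ->
  path_start r = path_start p /\ path_end r = path_end q.
Proof.
case/path_cat_some => e er; rewrite /path_end /path_start /path_arrows er /=.
by split=> //; rewrite map_cat last_cat -/(path_end p) e.
Qed.

Lemma path_catA p q r :
  obind (path_cat p) (path_cat q r) = obind (path_cat^~ r) (path_cat p q).
Proof.
case Eqr: (path_cat q r) => [qr|]; case Epq: (path_cat p q) => [pq|] //=.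
- have [sqr _] := path_end_cat Eqr; have [_ epq] := path_end_cat Epq.
  have /path_cat_some [eqr vqr] := Eqr; have /path_cat_some [epq' vpq] := Epq.
  case Eu: (path_cat pq r) => [u|]; last first.
    by move/path_cat_none: Eu; rewrite epq eqr.
  have /path_cat_some [_ vu] := Eu; apply/path_cat_some; rewrite sqr.
  by split=> //; rewrite vu /path_start /path_arrows vpq vqr /= catA.
- have [sqr _] := path_end_cat Eqr.
  by apply/path_cat_none; rewrite sqr; apply/path_cat_none.
- have [_ epq] := path_end_cat Epq.
  by symmetry; apply/path_cat_none; rewrite epq; apply/path_cat_none.
Qed.

Lemma path_cat1p x q :
  path_cat (trivial_path x) q = if x == path_start q then Some q else None.
Proof.
case: eqP => [->|ne]; last by apply/path_cat_none.
by apply/path_cat_some; split=> //; case: q => -[].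
Qed.

Lemma path_catp1 p x :
  path_cat p (trivial_path x) = if path_end p == x then Some p else None.
Proof.
case: eqP => [<-|ne]; last by apply/path_cat_none.
by apply/path_cat_some; split=> //; case: p => -[? ?] ?; rewrite /= cats0.
Qed.

End Paths.

(* Finitely supported functions from paths to K. *)
Definition path_algebra (K : fieldType) (Q : quiver) : Type := {malg K[qpath Q]}.

HB.instance Definition _ (K : fieldType) (Q : quiver) :=
  GRing.Zmodule.on (path_algebra K Q).

HB.lock
Definition path_algebra_scale (K : fieldType) (Q : quiver) (a : K)
    (f : path_algebra K Q) : path_algebra K Q :=
  a *: (f : {malg K[qpath Q]}).

Section PathAlgebraModule.
Variables (K : fieldType) (Q : quiver).

Local Notation scale := (@path_algebra_scale K Q).

Let scaleA a b v : scale a (scale b v) = scale (a * b) v.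
Proof. by rewrite path_algebra_scale.unlock scalerA. Qed.
Let scale1 : left_id 1 scale.
Proof. by move=> v; rewrite path_algebra_scale.unlock scale1r. Qed.
Let scaleDr : right_distributive scale +%R.
Proof. by move=> a v w; rewrite path_algebra_scale.unlock scalerDr. Qed.
Let scaleDl v : {morph scale^~ v : a b / a + b}.
Proof. by move=> a b; rewrite path_algebra_scale.unlock scalerDl. Qed.

HB.instance Definition _ := GRing.Zmodule_isLmodule.Build K (path_algebra K Q)
  scaleA scale1 scaleDr scaleDl.

Lemma mcoeff_scale a (f : path_algebra K Q) p : (a *: f)@_p = a * f@_p.
Proof.
have -> : a *: f = scale a f by [].
by rewrite path_algebra_scale.unlock mcoeffZ.
Qed.

Lemma msupp_scale_le a (f : path_algebra K Q) :
  (msupp (a *: f) `<=` msupp f)%fset.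
Proof.
have -> : a *: f = scale a f by [].
by rewrite path_algebra_scale.unlock msuppZ_le.
Qed.

End PathAlgebraModule.

HB.lock
Definition path_elt (K : fieldType) (Q : quiver) (p : qpath Q) :
  path_algebra K Q := << p >>.

Definition arrow_elt (K : fieldType) (Q : quiver) (a : arrow Q) :
  path_algebra K Q := path_elt K (arrow_path a).

Definition path_mul (K : fieldType) (Q : quiver) (p q : qpath Q) :
  path_algebra K Q := oapp (@path_elt K Q) 0 (path_cat p q).

HB.lock
Definition path_algebra_mul (K : fieldType) (Q : quiver)
    (f g : path_algebra K Q) : path_algebra K Q :=
  \sum_(p <- msupp f) \sum_(q <- msupp g) (f@_p * g@_q) *: path_mul K p q.

Section PathAlgebra.
Variables (K : fieldType) (Q : quiver).

Local Notation KQ := (path_algebra K Q).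
Local Notation path_elt := (@path_elt K Q).
Local Notation path_mul := (@path_mul K Q).
Local Notation path_algebra_mul := (@path_algebra_mul K Q).
Implicit Types (f g h : KQ) (p q r : qpath Q).

Definition path_algebra_one : KQ := \sum_(x : vertex Q) path_elt (trivial_path x).

Lemma mcoeff_path_elt p q : (path_elt p)@_q = (p == q)%:R.
Proof. by rewrite path_elt.unlock mcoeffU. Qed.

Lemma path_algebraE f : f = \sum_(p <- msupp f) f@_p *: path_elt p.
Proof.
rewrite [LHS]monalgE; apply: eq_bigr => p _; apply/malgP => q.
by rewrite mcoeff_scale mcoeff_path_elt mcoeffU mulr_natr.
Qed.

Let mulw (d1 d2 : {fset qpath Q}) f g :
  (msupp f `<=` d1)%fset -> (msupp g `<=` d2)%fset ->
  path_algebra_mul f g =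
  \sum_(p <- d1) \sum_(q <- d2) (f@_p * g@_q) *: path_mul p q.
Proof.
move=> le_d1 le_d2; rewrite path_algebra_mul.unlock (big_fset_incl _ le_d1) /=.
  apply/eq_bigr=> p _; apply/big_fset_incl => // q _ /mcoeff_outdom ->.
  by rewrite mulr0 scale0r.
move=> p _ /mcoeff_outdom fp.
by rewrite big1 // => q _; rewrite fp mul0r scale0r.
Qed.

Let mulDl : left_distributive path_algebra_mul +%R.
Proof.
move=> f g h.
rewrite (mulw (msuppD_le _ _) (fsubset_refl _)).
rewrite (mulw (fsubsetUl _ (msupp g)) (fsubset_refl _)).
rewrite (mulw (fsubsetUr (msupp f) _) (fsubset_refl _)).
rewrite -big_split /=; apply/eq_bigr=> p _.
rewrite -big_split /=; apply/eq_bigr=> q _.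
by rewrite mcoeffD mulrDl scalerDl.
Qed.

Let mulDr : right_distributive path_algebra_mul +%R.
Proof.
move=> h f g.
rewrite (mulw (fsubset_refl _) (msuppD_le _ _)).
rewrite (mulw (fsubset_refl _) (fsubsetUl _ (msupp g))).
rewrite (mulw (fsubset_refl _) (fsubsetUr (msupp f) _)).
rewrite -big_split /=; apply/eq_bigr=> p _.
rewrite -big_split /=; apply/eq_bigr=> q _.
by rewrite mcoeffD mulrDr scalerDl.
Qed.

Let mul0 : left_zero 0 path_algebra_mul.
Proof. by move=> f; apply: (addrI (path_algebra_mul 0 f)); rewrite -mulDl !addr0. Qed.

Let mulg0 : right_zero 0 path_algebra_mul.
Proof. by move=> f; apply: (addrI (path_algebra_mul f 0)); rewrite -mulDr !addr0. Qed.

Let mulZl a f g : path_algebra_mul (a *: f) g = a *: path_algebra_mul f g.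
Proof.
rewrite (mulw (msupp_scale_le _ _) (fsubset_refl _)).
rewrite path_algebra_mul.unlock scaler_sumr.
apply: eq_bigr => p _; rewrite scaler_sumr; apply: eq_bigr => q _.
by rewrite mcoeff_scale scalerA mulrA.
Qed.

Let mulZr a f g : path_algebra_mul f (a *: g) = a *: path_algebra_mul f g.
Proof.
rewrite (mulw (fsubset_refl _) (msupp_scale_le _ _)).
rewrite path_algebra_mul.unlock scaler_sumr.
apply: eq_bigr => p _; rewrite scaler_sumr; apply: eq_bigr => q _.
by rewrite mcoeff_scale scalerA mulrCA.
Qed.

Let mul_suml I (s : seq I) (F : I -> KQ) g :
  path_algebra_mul (\sum_(i <- s) F i) g = \sum_(i <- s) path_algebra_mul (F i) g.
Proof. by apply: (big_morph (path_algebra_mul^~ g)) => [? ?|]; [exact: mulDl|exact: mul0]. Qed.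

Let mul_sumr I (s : seq I) (F : I -> KQ) g :
  path_algebra_mul g (\sum_(i <- s) F i) = \sum_(i <- s) path_algebra_mul g (F i).
Proof. by apply: (big_morph (path_algebra_mul g)) => [? ?|]; [exact: mulDr|exact: mulg0]. Qed.

Let mulUU p q : path_algebra_mul (path_elt p) (path_elt q) = path_mul p q.
Proof.
have le r : (msupp (path_elt r) `<=` [fset r])%fset.
  by rewrite path_elt.unlock; exact: msuppU_le.
rewrite (mulw (le p) (le q)) !big_seq_fset1 !mcoeff_path_elt !eqxx mulr1.
exact: scale1r.
Qed.

Let span_ind (P : KQ -> Prop) :
  P 0 -> (forall f g, P f -> P g -> P (f + g)) ->
  (forall a p, P (a *: path_elt p)) -> forall f, P f.
Proof.
by move=> P0 PD PZ f; rewrite [f]path_algebraE; apply: (big_ind P).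
Qed.

Let mulA : associative path_algebra_mul.
Proof.
move=> f g h; elim/span_ind: f => [|f1 f2 e1 e2|a p].
- by rewrite !mul0.
- by rewrite !mulDl e1 e2.
rewrite !mulZl; congr (_ *: _); elim/span_ind: g => [|g1 g2 e1 e2|b q].
- by rewrite !(mul0, mulg0).
- by rewrite !(mulDl, mulDr) e1 e2.
rewrite !(mulZl, mulZr); congr (_ *: _); elim/span_ind: h => [|h1 h2 e1 e2|c r].
- by rewrite !(mul0, mulg0).
- by rewrite !(mulDl, mulDr) e1 e2.
rewrite !mulZr; congr (_ *: _); rewrite !mulUU /path_mul.
have := path_catA p q r.
case: (path_cat q r) => [qr|]; case: (path_cat p q) => [pq|] //= e.
- by rewrite !mulUU /path_mul e.
- by rewrite mulUU /path_mul e mul0.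
- by rewrite mulUU /path_mul -e mulg0.
- by rewrite mul0 mulg0.
Qed.

Let mul1 : left_id path_algebra_one path_algebra_mul.
Proof.
move=> f; elim/span_ind: f => [|f1 f2 e1 e2|a p]; first exact: mulg0.
  by rewrite mulDr e1 e2.
rewrite mulZr; congr (_ *: _); rewrite mul_suml (bigD1 (path_start p)) //= big1.
  by rewrite addr0 mulUU /path_mul path_cat1p eqxx.
by move=> x /negPf ne; rewrite mulUU /path_mul path_cat1p ne.
Qed.

Let mulg1 : right_id path_algebra_one path_algebra_mul.
Proof.
move=> f; elim/span_ind: f => [|f1 f2 e1 e2|a p]; first exact: mul0.
  by rewrite mulDl e1 e2.
rewrite mulZl; congr (_ *: _); rewrite mul_sumr (bigD1 (path_end p)) //= big1.
  by rewrite addr0 mulUU /path_mul path_catp1 eqxx.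
by move=> x ne; rewrite mulUU /path_mul path_catp1 eq_sym (negPf ne).
Qed.

Let one_neq0 : path_algebra_one != 0.
Proof.
have /card_gt0P [x _] := quiver_nonempty Q.
apply/eqP => /malgP /(_ (trivial_path x)) /eqP.
rewrite mcoeff0 raddf_sum (bigD1 x) //= big1.
  by rewrite addr0 mcoeff_path_elt eqxx oner_eq0.
move=> y ne; rewrite mcoeff_path_elt; case: eqP => // /(congr1 val) [e].
by rewrite e eqxx in ne.
Qed.

HB.instance Definition _ := GRing.Zmodule_isNzRing.Build KQ
  mulA mul1 mulg1 mulDl mulDr one_neq0.

HB.instance Definition _ := GRing.Lmodule_isLalgebra.Build K KQ
  (fun a f g => esym (mulZl a f g)).

HB.instance Definition _ := GRing.Lalgebra_isAlgebra.Build K KQ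
  (fun a f g => esym (mulZr a f g)).

Lemma path_algebra1E :
  1 = \sum_(x : vertex Q) path_elt (trivial_path x) :> KQ.
Proof. by []. Qed.

Lemma path_eltM p q : path_elt p * path_elt q = path_mul p q.
Proof. exact: mulUU. Qed.

End PathAlgebra.

Definition arrow_ideal (K : fieldType) (Q : quiver) : set (path_algebra K Q) :=
  ideal_generated (range (@arrow_elt K Q)).

Arguments arrow_ideal K Q : clear implicits.

Definition admissible (K : fieldType) (Q : quiver) (I : set (path_algebra K Q)) :
    Prop :=
  exists2 m, (2 <= m)%N &
    ideal_exp (arrow_ideal K Q) m `<=` I /\ I `<=` ideal_exp (arrow_ideal K Q) 2.

Definition bound_quiver_algebra (K : fieldType) (Q : quiver)
    (I : proper_twosided_ideal (path_algebra K Q)) : algType K :=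
  quotient_algebra I.

Definition arrow_free_socle (K : fieldType) (Q : quiver)
    (I : proper_twosided_ideal (path_algebra K Q)) : Prop :=
  forall a : arrow Q,
    ~ left_socle (bound_quiver_algebra I) (quotient_map I (arrow_elt K a)) /\
    ~ right_socle (bound_quiver_algebra I) (quotient_map I (arrow_elt K a)).

(* Main.v *)
(* Let N be the radical of A and call an arrow c : i -> j a socle arrow when   *)
(* N c = 0.  Self-injectivity is used only through principal left ideals: if   *)
(* l(z) is contained in l(w) (left annihilators), then w = z y for some y.     *)
(* Comparing coefficients of paths of length at most one, this shows that a    *)
(* socle arrow c is the only arrow ending at j and that c N = 0; hence every   *)
(* arrow starting at j is again a socle arrow.  Injectivity, hence             *)
(* bijectivity, of the Nakayama map provides an arrow starting at j, so by     *)
(* finiteness the sources and the targets of socle arrows form the same set S, *)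
(* and no other arrow touches S.  Then \sum_(v in S) e_v is a nonzero central  *)
(* idempotent, equal to 1 by indecomposability; all arrows are socle arrows    *)
(* and N^2 = 0.  An arrow a in the right socle is also in the left one: the    *)
(* left socle element z at the source of a satisfies l(a) <= l(z), so z is a   *)
(* right multiple of a, hence a scalar multiple.                               *)
Require Import Defs.
From HB Require Import structures.
From mathcomp Require Import all_boot all_algebra.
From mathcomp Require Import finmap monalg.
From mathcomp Require Import boolp classical_sets.

Set Implicit Arguments.
Unset Strict Implicit.
Unset Printing Implicit Defensive.

Import GRing.Theory.

(** An arrow in the left socle is killed from the left by the radical N ([left_socle_annihilated]);
    an arrow in the right socle is too, by [right_socle_annihilated] and
    [arr_right_annihilated_left]. One such arrow already forces N^2 = 0
    ([socle_arrow_radical_square_zero]). Two tools carry the computations: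
    [self_injective_principal] turns an inclusion of left annihilators into a divisibility, and, as
    I lies in the square of the arrow ideal, coefficients of paths of length at most one descend to
    A with the product rules [vertex_coefM] and [arrow_coefM]. *)

(** * Principal left ideals of a self-injective ring *)

Section PrincipalLeftIdeal.
Local Open Scope ring_scope.
Variables (A : nzRingType) (z : A).

Definition principal : {pred A^o} := fun x => `[< exists a : A, x = a * z >].

Lemma principalP (x : A^o) : reflect (exists a : A, x = a * z) (x \in principal).
Proof. exact: asboolP. Qed.

Lemma principal_submod_closed : submod_closed principal.
Proof.
split; first by apply/principalP; exists 0; rewrite mul0r.
move=> k _ _ /principalP[a ->] /principalP[b ->]; apply/principalP.
by exists (k * a + b); rewrite mulrDl -mulrA.
Qed.

HB.instance Definition _ := GRing.isSubmodClosed.Build A A^o principal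
  principal_submod_closed.

(** [injective_module] quantifies over module types, so the ideal A z is packed as a type. *)
Record principal_ideal := PrincipalIdeal {
  principal_val : A^o;
  _ : principal_val \in principal
}.

HB.instance Definition _ := [isSub for principal_val].
HB.instance Definition _ := [Choice of principal_ideal by <:].
HB.instance Definition _ := [SubChoice_isSubLmodule of principal_ideal by <:].

(** The annihilator condition makes a z -> a w well defined on A z; injectivity extends it to some
    [h] on A, and w = h(z) = z h(1). *)
Lemma self_injective_principal (w : A) : self_injective A ->
  (forall x : A, x * z = 0 -> x * w = 0) -> exists y, w = z * y.
Proof.
move=> injA ann.
have coefP (x : principal_ideal) : exists a : A, principal_val x = a * z.
  exact/principalP/valP.
pose g (x : principal_ideal) : A^o := projT1 (cid (coefP x)) * w.
have gE x a : principal_val x = a * z -> g x = a * w.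
  rewrite /g; case: cid => b /= -> /eqP; rewrite -subr_eq0 -mulrBl => /eqP/ann.
  by rewrite mulrBl => /subr0_eq.
have glin : linear g.
  move=> k x y; have [a xa] := coefP x; have [b yb] := coefP y.
  rewrite (gE x a xa) (gE y b yb).
  transitivity ((k * a + b) * w); last by rewrite mulrDl -mulrA.
  apply: gE.
  by rewrite [LHS]/(k * principal_val x + principal_val y) xa yb mulrDl mulrA.
pose gl : {linear principal_ideal -> A^o} :=
  HB.pack g (GRing.isLinear.Build _ _ _ _ g glin).
have zP : (z : A^o) \in principal by apply/principalP; exists 1; rewrite mul1r.
have [h hE] := injA _ _ (\val : {linear principal_ideal -> A^o}) gl val_inj.
exists (h 1).
have := hE (PrincipalIdeal zP).
rewrite /= (gE _ 1) ?mul1r// => <-.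
by rewrite -[LHS]/(h z) -[in LHS](mulr1 z) -[z * 1]/(z *: (1 : A^o)) linearZ.
Qed.

End PrincipalLeftIdeal.

(** * Central idempotents and product decompositions *)

Section CentralIdempotent.
Local Open Scope ring_scope.
Variables (K : fieldType) (A : algType K).

Lemma central_annihilator_ideal (e : A) : (forall x, x * e = e * x) ->
  is_ideal [set x : A | x * e = 0].
Proof.
move=> ce; split=> /=.
- by rewrite mul0r.
- by move=> x y xe ye; rewrite mulrDl xe ye addr0.
- by move=> a x xe; rewrite -mulrA xe mulr0.
- by move=> a x xe; rewrite -mulrA ce mulrA xe mul0r.
Qed.

(** Otherwise, with f = 1 - e, A is the product of its quotients by the annihilators of e and f,
    which are two-sided by centrality and proper because e and f are nonzero. *)
Lemma indecomposable_central_idempotent (e : A) : indecomposable_algebra A ->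
  (forall x, x * e = e * x) -> e * e = e -> e = 0 \/ e = 1.
Proof.
move=> indA ce ee.
have [/eqP|ne0] := boolP (e == 0); [by left | right].
apply: contrapT => ne1; apply: indA.
pose f : A := 1 - e.
have cf x : x * f = f * x by rewrite mulrBr mulrBl mulr1 mul1r ce.
have ef : e * f = 0 by rewrite mulrBr mulr1 ee subrr.
have fe : f * e = 0 by rewrite -cf.
have ff : f * f = f by rewrite {1}/f mulrBl mul1r ef subr0.
have pe : ~ [set x : A | x * e = 0]%classic 1 by rewrite /= mul1r; apply/eqP.
have pf : ~ [set x : A | x * f = 0]%classic 1.
  by rewrite /= mul1r => /subr0_eq/esym.
pose Ie := Defs.ProperIdeal (central_annihilator_ideal ce) pe.
pose If := Defs.ProperIdeal (central_annihilator_ideal cf) pf.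
pose h (x : A) : (quotient_algebra Ie * quotient_algebra If)%type :=
  (quotient_map Ie x, quotient_map If x).
have hlin : linear h by move=> k x y; rewrite /h !linearP.
have hmul : monoid_morphism h.
  by split=> [|x y]; rewrite /h ?rmorph1 // !rmorphM.
pose hl : {lrmorphism A -> (quotient_algebra Ie * quotient_algebra If)%type} :=
  HB.pack h (GRing.isLinear.Build _ _ _ _ h hlin)
    (GRing.isMonoidMorphism.Build _ _ h hmul).
exists (quotient_algebra Ie), (quotient_algebra If), hl.
(* The inverse rests on x = x e + x f; multiplying by e and f removes the dependence on
   representatives. *)
exists (fun p => repr p.1 * e + repr p.2 * f) => [x|[y1 y2]] /=.
  have /= he : ideal_set Ie (repr (quotient_map Ie x) - x).
    by apply/quotient_map_eq; exact: reprK.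
  have /= hf : ideal_set If (repr (quotient_map If x) - x).
    by apply/quotient_map_eq; exact: reprK.
  move: he hf; rewrite !mulrBl => /subr0_eq -> /subr0_eq ->.
  by rewrite -mulrDr addrC subrK mulr1.
rewrite /h; congr pair.
  transitivity (quotient_map Ie (repr y1)); last exact: reprK.
  apply/quotient_map_eq => /=.
  by rewrite mulrBl mulrDl -!mulrA ee fe mulr0 addr0 subrr.
transitivity (quotient_map If (repr y2)); last exact: reprK.
apply/quotient_map_eq => /=.
by rewrite mulrBl mulrDl -!mulrA ff ef mulr0 add0r subrr.
Qed.

End CentralIdempotent.

(** * Coefficients of short paths in the path algebra *)

Section PathAlgebraTheory.
Local Open Scope ring_scope.
Variables (K : fieldType) (Q : quiver).
Local Notation KQ := (path_algebra K Q).
Implicit Types (v : vertex Q) (a b : arrow Q) (f g : KQ) (p q : qpath Q).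

Definition vertex_elt v : KQ := path_elt K (trivial_path v).

Lemma path_algebra_span_ind (P : KQ -> Prop) :
  (forall (k : K) f, P f -> P (k *: f)) -> (forall f g, P f -> P g -> P (f + g)) ->
  (forall p, P (path_elt K p)) -> forall f, P f.
Proof.
move=> PZ PD Pp f; rewrite [f]path_algebraE; apply: (big_ind P) => //.
  have /card_gt0P [x _] := quiver_nonempty Q.
  by rewrite -(scale0r (vertex_elt x)); exact/PZ/Pp.
by move=> p _; apply/PZ/Pp.
Qed.

Lemma path_elt_cat p q r : path_cat p q = Some r ->
  path_elt K r = path_elt K p * path_elt K q.
Proof. by move=> e; rewrite path_eltM /path_mul e. Qed.

Lemma path_algebra_ind_left (P : KQ -> Prop) :
  (forall (k : K) f, P f -> P (k *: f)) -> (forall f g, P f -> P g -> P (f + g)) ->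
  (forall v, P (vertex_elt v)) -> (forall a f, P f -> P (arrow_elt K a * f)) ->
  forall f, P f.
Proof.
move=> PZ PD Pv Pa; apply: path_algebra_span_ind => // -[[x s] xs].
elim: s x xs => [|a s IHs] x xs.
  suff -> : QPath xs = trivial_path x by exact: Pv.
  exact/val_inj.
have /= /andP[/eqP sa ts] := xs.
rewrite (@path_elt_cat (arrow_path a) (@QPath _ (target a, s) ts)).
  exact/Pa/IHs.
by apply/path_cat_some; split => //=; rewrite /path_start /= sa.
Qed.

Lemma path_algebra_ind_right (P : KQ -> Prop) :
  (forall (k : K) f, P f -> P (k *: f)) -> (forall f g, P f -> P g -> P (f + g)) ->
  (forall v, P (vertex_elt v)) -> (forall a f, P f -> P (f * arrow_elt K a)) ->
  forall f, P f.
Proof.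
move=> PZ PD Pv Pa; apply: path_algebra_span_ind => // -[[x s] xs].
elim/last_ind: s xs => [|s a IHs] xs.
  suff -> : QPath xs = trivial_path x by exact: Pv.
  exact/val_inj.
have /andP[xs' /eqP sa] :
    composable x s && (source a == last x (map (@target Q) s)).
  by move: xs; rewrite /= -cats1 composable_cat /= andbT.
rewrite (@path_elt_cat (@QPath _ (x, s) xs') (arrow_path a)).
  exact/Pa/IHs.
by apply/path_cat_some; split => //=; rewrite /path_start /path_arrows /= cats1.
Qed.

Lemma mcoeff_path_mul p q r :
  (path_mul K p q)@_r = (path_cat p q == Some r)%:R.
Proof.
rewrite /path_mul; case: path_cat => [u|] /=; last by rewrite mcoeff0.
exact: mcoeff_path_elt.
Qed.

Lemma path_cat_trivial p q v :
  (path_cat p q == Some (trivial_path v)) =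
  (p == trivial_path v) && (q == trivial_path v).
Proof.
apply/eqP/andP => [|[/eqP-> /eqP->]]; last by rewrite path_cat1p eqxx.
case: p q => [[x s] xs] [[y t] yt] /path_cat_some.
rewrite /path_end /path_start /path_arrows /= => -[+ [xv]].
case: s xs => [|a s] xs; case: t yt => [|b t] yt //= xy _.
by split; apply/eqP/val_inj => /=; rewrite -?xy xv.
Qed.

Lemma path_cat_arrow p q a :
  (path_cat p q == Some (arrow_path a)) =
  (p == trivial_path (source a)) && (q == arrow_path a)
  || (p == arrow_path a) && (q == trivial_path (target a)).
Proof.
apply/eqP/orP => [|[]/andP[/eqP-> /eqP->]]; last first.
- by rewrite path_catp1 eqxx.
- by rewrite path_cat1p eqxx.
case: p q => [[x s] xs] [[y t] yt] /path_cat_some.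
rewrite /path_end /path_start /path_arrows /= => -[+ [xv]].
case: s xs => [|b s] xs /= xy.
  by move=> e; left; apply/andP; split; apply/eqP/val_inj => /=; rewrite -?xy ?xv ?e.
case: s xs xy => [|? ?] xs //=; case: t yt => [|? ?] yt //= xy [ba].
by right; apply/andP; split; apply/eqP/val_inj => /=; rewrite -?xy ?xv -?ba ?xv.
Qed.

(** A concatenation is trivial only if both factors are. *)
Lemma mcoeff_mul_trivial f g v :
  (f * g)@_(trivial_path v) = f@_(trivial_path v) * g@_(trivial_path v).
Proof.
elim/path_algebra_span_ind: f => [k f IHf|f1 f2 IH1 IH2|p].
- by rewrite -scalerAl !mcoeff_scale IHf mulrA.
- by rewrite mulrDl !mcoeffD IH1 IH2 mulrDl.
elim/path_algebra_span_ind: g => [k g IHg|g1 g2 IH1 IH2|q].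
- by rewrite -scalerAr !mcoeff_scale IHg mulrCA.
- by rewrite mulrDr !mcoeffD IH1 IH2 mulrDr.
by rewrite path_eltM mcoeff_path_mul path_cat_trivial !mcoeff_path_elt -natrM mulnb.
Qed.

(** A Leibniz rule: an arrow factors only through a trivial path at one of its ends. *)
Lemma mcoeff_mul_arrow f g a :
  (f * g)@_(arrow_path a) =
  f@_(trivial_path (source a)) * g@_(arrow_path a) +
  f@_(arrow_path a) * g@_(trivial_path (target a)).
Proof.
elim/path_algebra_span_ind: f => [k f IHf|f1 f2 IH1 IH2|p].
- by rewrite -scalerAl !mcoeff_scale IHf mulrDr !mulrA.
- by rewrite mulrDl !mcoeffD IH1 IH2 !mulrDl addrACA.
elim/path_algebra_span_ind: g => [k g IHg|g1 g2 IH1 IH2|q].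
- by rewrite -scalerAr !mcoeff_scale IHg mulrDr !(mulrCA k).
- by rewrite mulrDr !mcoeffD IH1 IH2 !mulrDr addrACA.
rewrite path_eltM mcoeff_path_mul path_cat_arrow !mcoeff_path_elt -!natrM !mulnb.
rewrite -natrD; congr _%:R.
case: (eqVneq p (arrow_path a)) => [->|ne] /=; last by rewrite orbF addn0.
suff /negPf-> : arrow_path a != trivial_path (source a) by [].
by apply/eqP => /(congr1 val).
Qed.

Lemma mcoeff_vertex_elt v w : (vertex_elt v)@_(trivial_path w) = (v == w)%:R.
Proof.
rewrite mcoeff_path_elt; congr (nat_of_bool _)%:R.
by apply/eqP/eqP => [/(congr1 val)[]|->].
Qed.

Lemma mcoeff_arrow_elt_trivial a v : (arrow_elt K a)@_(trivial_path v) = 0.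
Proof. by rewrite mcoeff_path_elt; case: eqP => // /(congr1 val). Qed.

(** Group the nontrivial paths by their first arrow, respectively by their last. *)
Lemma vertex_elt_decomposition f :
  (exists F : arrow Q -> KQ,
     f = \sum_v f@_(trivial_path v) *: vertex_elt v + \sum_a arrow_elt K a * F a) /\
  (exists F : arrow Q -> KQ,
     f = \sum_v f@_(trivial_path v) *: vertex_elt v + \sum_a F a * arrow_elt K a).
Proof.
have ve v : vertex_elt v = \sum_w (vertex_elt v)@_(trivial_path w) *: vertex_elt w.
  rewrite (bigD1 v) //= big1 ?mcoeff_vertex_elt ?eqxx ?scale1r ?addr0// => w /negPf wv.
  by rewrite mcoeff_vertex_elt eq_sym wv scale0r.
split.
- elim/path_algebra_ind_left: f => [k f [F {1}->]|f g [F {1}->] [G {1}->]|v|a f _].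
  + exists (fun a => k *: F a); rewrite scalerDr !scaler_sumr; congr (_ + _).
      by apply: eq_bigr => v _; rewrite scalerA mcoeff_scale.
    by apply: eq_bigr => a _; rewrite scalerAr.
  + exists (fun a => F a + G a); rewrite addrACA -!big_split /=; congr (_ + _).
      by apply: eq_bigr => v _; rewrite -scalerDl mcoeffD.
    by apply: eq_bigr => a _; rewrite mulrDr.
  + by exists (fun=> 0); rewrite -ve [X in _ + X]big1 ?addr0// => a _; rewrite mulr0.
  + exists (fun b => if b == a then f else 0).
    rewrite big1 => [|v _]; last by rewrite mcoeff_mul_trivial mcoeff_arrow_elt_trivial mul0r scale0r.
    rewrite add0r (bigD1 a)//= eqxx big1 ?addr0// => b /negPf->; exact: mulr0.
- elim/path_algebra_ind_right: f => [k f [F {1}->]|f g [F {1}->] [G {1}->]|v|a f _].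
  + exists (fun a => k *: F a); rewrite scalerDr !scaler_sumr; congr (_ + _).
      by apply: eq_bigr => v _; rewrite scalerA mcoeff_scale.
    by apply: eq_bigr => a _; rewrite scalerAl.
  + exists (fun a => F a + G a); rewrite addrACA -!big_split /=; congr (_ + _).
      by apply: eq_bigr => v _; rewrite -scalerDl mcoeffD.
    by apply: eq_bigr => a _; rewrite mulrDl.
  + by exists (fun=> 0); rewrite -ve [X in _ + X]big1 ?addr0// => a _; rewrite mul0r.
  + exists (fun b => if b == a then f else 0).
    rewrite big1 => [|v _]; last by rewrite mcoeff_mul_trivial mcoeff_arrow_elt_trivial mulr0 scale0r.
    rewrite add0r (bigD1 a)//= eqxx big1 ?addr0// => b /negPf->; exact: mul0r.
Qed.

End PathAlgebraTheory.

(** * The arrow ideal and its powers *)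

Section ArrowIdeal.
Local Open Scope ring_scope.
Variables (K : fieldType) (Q : quiver).
Local Notation KQ := (path_algebra K Q).
Local Notation R := (arrow_ideal K Q).
Implicit Types (v : vertex Q) (a : arrow Q) (f g : KQ).

Lemma arrow_ideal_is_ideal : is_ideal R.
Proof.
split.
- by move=> J [] /ideal0.
- by move=> x y Rx Ry J HJ; case: (HJ) => HI _; apply: (idealD HI); [exact: Rx|exact: Ry].
- by move=> a x Rx J HJ; case: (HJ) => HI _; apply: (idealMl HI); exact: Rx.
- by move=> a x Rx J HJ; case: (HJ) => HI _; apply: (Defs.idealMr HI); exact: Rx.
Qed.

Lemma arrow_elt_arrow_ideal a : R (arrow_elt K a).
Proof. by move=> J [_]; apply; exists a. Qed.

Lemma arrow_idealP f : R f <-> forall v, f@_(trivial_path v) = 0.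
Proof.
split=> [Rf v|f0].
  apply: (Rf [set g : KQ | g@_(trivial_path v) = 0]%classic); split.
    split => /= [|x y|a x|a x]; rewrite ?mcoeff0 ?mcoeffD ?mcoeff_mul_trivial //.
    - by move=> -> ->; rewrite addr0.
    - by move=> ->; rewrite mulr0.
    - by move=> ->; rewrite mul0r.
  by move=> _ [a _ <-] /=; exact: mcoeff_arrow_elt_trivial.
have [[F ->] _] := vertex_elt_decomposition f.
rewrite big1 => [|v _]; last by rewrite f0 scale0r.
rewrite add0r; have HI := arrow_ideal_is_ideal; apply: (big_ind R).
- exact: (ideal0 HI).
- exact: (idealD HI).
- by move=> a _; apply: (Defs.idealMr HI); exact: arrow_elt_arrow_ideal.
Qed.

Lemma prod_arrow_ideal (s : seq KQ) : (forall f, f \in s -> R f) ->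
  ideal_exp R (size s) (\prod_(f <- s) f).
Proof.
elim: s => [//|f s IHs] Rs; rewrite big_cons.
exists [:: (f, \prod_(g <- s) g)]; last by rewrite big_seq1.
move=> _ /[1!inE] /eqP-> /=; split; first by apply: Rs; rewrite inE eqxx.
by apply: IHs => g gs; apply: Rs; rewrite inE gs orbT.
Qed.

Lemma mcoeff_arrow_ideal_sqr f : ideal_exp R 2 f ->
  (forall v, f@_(trivial_path v) = 0) /\ (forall a, f@_(arrow_path a) = 0).
Proof.
case=> s sR ->.
(* [ideal_exp] ends in [setT], so [p.2] is a sum of products with only the left factors known to lie
   in [R]. *)
have triv0 p v : p \in s -> p.1@_(trivial_path v) = 0 /\ p.2@_(trivial_path v) = 0.
  move=> /sR [] /arrow_idealP R1 [t tR ->]; split; first exact: R1.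
  rewrite raddf_sum big_seq big1 // => q /tR [/arrow_idealP Rq _].
  by rewrite /= mcoeff_mul_trivial Rq mul0r.
split=> [v|a]; rewrite raddf_sum big_seq big1 // => p ps /=.
  by rewrite mcoeff_mul_trivial (triv0 _ v ps).1 mul0r.
by rewrite mcoeff_mul_arrow (triv0 _ _ ps).1 (triv0 _ _ ps).2 mul0r mulr0 addr0.
Qed.

End ArrowIdeal.

(** * Short-path coefficients in the bound quiver algebra *)

Section BoundQuiverAlgebra.
Local Open Scope ring_scope.
Variables (K : fieldType) (Q : quiver).
Variable I : proper_twosided_ideal (path_algebra K Q).
Hypothesis admI : admissible I.
Local Notation A := (bound_quiver_algebra I).
Local Notation pi := (quotient_map I).
Implicit Types (v w : vertex Q) (a b c d : arrow Q) (x y z : A).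

Definition vtx v : A := pi (vertex_elt K v).
Definition arr a : A := pi (arrow_elt K a).

(* Meaningful because an admissible ideal contains no combination of paths of *)
(* length at most one, so the choice of representative does not matter.       *)
Definition vertex_coef v x : K := (repr (x : quotient_algebra I))@_(trivial_path v).
Definition arrow_coef a x : K := (repr (x : quotient_algebra I))@_(arrow_path a).

Lemma vertex_coef_pi v f : vertex_coef v (pi f) = f@_(trivial_path v).
Proof.
have [m _ [_ le2]] := admI.
have : ideal_set I (repr (pi f) - f) by apply/quotient_map_eq; exact: reprK.
by move=> /le2 /mcoeff_arrow_ideal_sqr[/(_ v) + _]; rewrite mcoeffB => /subr0_eq.
Qed.

Lemma arrow_coef_pi a f : arrow_coef a (pi f) = f@_(arrow_path a).
Proof.
have [m _ [_ le2]] := admI.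
have : ideal_set I (repr (pi f) - f) by apply/quotient_map_eq; exact: reprK.
by move=> /le2 /mcoeff_arrow_ideal_sqr[_ /(_ a)]; rewrite mcoeffB => /subr0_eq.
Qed.

Lemma vertex_coefD v x y : vertex_coef v (x + y) = vertex_coef v x + vertex_coef v y.
Proof.
have [f <-] := quotient_map_surj x; have [g <-] := quotient_map_surj y.
by rewrite -[pi f + pi g]raddfD !vertex_coef_pi mcoeffD.
Qed.

Lemma vertex_coefM v x y : vertex_coef v (x * y) = vertex_coef v x * vertex_coef v y.
Proof.
have [f <-] := quotient_map_surj x; have [g <-] := quotient_map_surj y.
by rewrite -[pi f * pi g]rmorphM !vertex_coef_pi mcoeff_mul_trivial.
Qed.

Lemma vertex_coefZ v k x : vertex_coef v (k *: x) = k * vertex_coef v x.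
Proof.
have [f <-] := quotient_map_surj x.
by rewrite -[k *: pi f]linearZ !vertex_coef_pi mcoeff_scale.
Qed.

Lemma arrow_coefD a x y : arrow_coef a (x + y) = arrow_coef a x + arrow_coef a y.
Proof.
have [f <-] := quotient_map_surj x; have [g <-] := quotient_map_surj y.
by rewrite -[pi f + pi g]raddfD !arrow_coef_pi mcoeffD.
Qed.

Lemma arrow_coefM a x y : arrow_coef a (x * y) =
  vertex_coef (source a) x * arrow_coef a y + arrow_coef a x * vertex_coef (target a) y.
Proof.
have [f <-] := quotient_map_surj x; have [g <-] := quotient_map_surj y.
by rewrite -[pi f * pi g]rmorphM !vertex_coef_pi !arrow_coef_pi mcoeff_mul_arrow.
Qed.

Lemma vertex_coef_vtx v w : vertex_coef v (vtx w) = (v == w)%:R.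
Proof. by rewrite vertex_coef_pi mcoeff_vertex_elt eq_sym. Qed.

Lemma vertex_coef_arr v a : vertex_coef v (arr a) = 0.
Proof. by rewrite vertex_coef_pi mcoeff_arrow_elt_trivial. Qed.

Lemma arrow_coef_arr a b : arrow_coef a (arr b) = (a == b)%:R.
Proof.
rewrite arrow_coef_pi mcoeff_path_elt eq_sym; congr (nat_of_bool _)%:R.
by apply/eqP/eqP => [/(congr1 val)[_ ->]|->].
Qed.

Lemma arrow_coef0 a : arrow_coef a 0 = 0.
Proof. by rewrite -[0 in LHS](raddf0 pi) arrow_coef_pi mcoeff0. Qed.

Lemma vertex_coef0 v : vertex_coef v 0 = 0.
Proof. by rewrite -[0 in LHS](raddf0 pi) vertex_coef_pi mcoeff0. Qed.

Lemma vertex_coef1 v : vertex_coef v 1 = 1.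
Proof.
rewrite -[1 in LHS](rmorph1 pi) vertex_coef_pi path_algebra1E raddf_sum.
rewrite (bigD1 v)//= mcoeff_path_elt eqxx big1 ?addr0// => w /negPf wv.
by rewrite -[path_elt K _]/(vertex_elt K w) mcoeff_vertex_elt wv.
Qed.

Lemma sum_vtx : \sum_v vtx v = 1.
Proof. by rewrite -[LHS](raddf_sum pi) -[RHS](rmorph1 pi) path_algebra1E. Qed.

Lemma vtxM v w : vtx v * vtx w = if v == w then vtx v else 0.
Proof.
rewrite -[LHS]rmorphM path_eltM /path_mul path_cat1p [path_start _]/=.
by case: eqVneq => [e|_] /=; rewrite ?e // -[RHS](raddf0 pi).
Qed.

Lemma vtx_arr v a : vtx v * arr a = if v == source a then arr a else 0.
Proof.
rewrite -[LHS]rmorphM path_eltM /path_mul path_cat1p [path_start _]/=.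
by case: eqVneq => [e|_] /=; rewrite ?e // -[RHS](raddf0 pi).
Qed.

Lemma arr_vtx v a : arr a * vtx v = if v == target a then arr a else 0.
Proof.
rewrite -[LHS]rmorphM path_eltM /path_mul path_catp1 [path_end _]/= eq_sym.
by case: eqVneq => [e|_] /=; rewrite ?e // -[RHS](raddf0 pi).
Qed.

Lemma vtx_arr_decomposition_left x : exists F : arrow Q -> A,
  x = \sum_v vertex_coef v x *: vtx v + \sum_a arr a * F a.
Proof.
have [f <-] := quotient_map_surj x.
have [[F fE] _] := vertex_elt_decomposition f; exists (fun a => pi (F a)).
rewrite {1}fE raddfD !raddf_sum; congr (_ + _); apply: eq_bigr => i _ /=.
  by rewrite vertex_coef_pi; exact: linearZ.
exact: rmorphM.
Qed.

Lemma vtx_arr_decomposition_right x : exists F : arrow Q -> A,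
  x = \sum_v vertex_coef v x *: vtx v + \sum_a F a * arr a.
Proof.
have [f <-] := quotient_map_surj x.
have [_ [F fE]] := vertex_elt_decomposition f; exists (fun a => pi (F a)).
rewrite {1}fE raddfD !raddf_sum; congr (_ + _); apply: eq_bigr => i _ /=.
  by rewrite vertex_coef_pi; exact: linearZ.
exact: rmorphM.
Qed.

(** * The radical and the socles *)

(** The image of the arrow ideal, that is, the radical N in coordinates. *)
Definition radical_elt x : Prop := forall v, vertex_coef v x = 0.

Lemma radical_elt_nilpotent : exists m, forall s : seq A,
  (forall x, x \in s -> radical_elt x) -> size s = m -> \prod_(x <- s) x = 0.
Proof.
have [m _ [nil _]] := admI; exists m => s rs sm.
pose r (x : A) : path_algebra K Q := repr (x : quotient_algebra I).
have -> : \prod_(x <- s) x = pi (\prod_(f <- map r s) f).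
  by rewrite rmorph_prod big_map; apply: eq_bigr => x _; rewrite [RHS]reprK.
rewrite -[RHS](raddf0 pi); apply/quotient_map_eq; rewrite subr0; apply: nil.
rewrite -sm -(size_map r); apply: prod_arrow_ideal => _ /mapP[x xs ->].
by apply/arrow_idealP => v; exact: rs.
Qed.

Lemma radical_eltMl x y : radical_elt y -> radical_elt (x * y).
Proof. by move=> ry v; rewrite vertex_coefM ry mulr0. Qed.

Lemma radical_eltMr x y : radical_elt x -> radical_elt (x * y).
Proof. by move=> rx v; rewrite vertex_coefM rx mul0r. Qed.

Lemma radical_elt_arr a : radical_elt (arr a).
Proof. by move=> v; exact: vertex_coef_arr. Qed.

Lemma arr_neq0 a : arr a <> 0.
Proof.
move=> /(congr1 (arrow_coef a)) /eqP.
by rewrite arrow_coef_arr eqxx arrow_coef0 oner_eq0.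
Qed.

(** Multiply [x] by radical elements as long as the product stays nonzero; nilpotency makes this
    stop. *)
Lemma left_multiple_annihilated_by_radical x : x <> 0 ->
  exists y, y * x <> 0 /\ forall n, radical_elt n -> n * (y * x) = 0.
Proof.
move=> x0; apply: contrapT => nex; have [m nil] := radical_elt_nilpotent.
have grow k : exists s : seq A,
    [/\ forall n, n \in s -> radical_elt n, size s = k & (\prod_(n <- s) n) * x <> 0].
  elim: k => [|k [s [rs sk sx]]]; first by exists [::]; rewrite big_nil mul1r.
  apply: contrapT => nex'; apply: nex; exists (\prod_(n <- s) n); split=> // n rn.
  apply: contrapT => nx; apply: nex'; exists (n :: s).
  rewrite big_cons -mulrA /= sk; split=> // u; rewrite inE => /orP[/eqP->//|].
  exact: rs.
have [s [rs sm]] := grow m; apply.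
by rewrite (nil s rs sm) mul0r.
Qed.

Lemma right_multiple_annihilated_by_radical x : x <> 0 ->
  exists y, x * y <> 0 /\ forall n, radical_elt n -> x * y * n = 0.
Proof.
move=> x0; apply: contrapT => nex; have [m nil] := radical_elt_nilpotent.
have grow k : exists s : seq A,
    [/\ forall n, n \in s -> radical_elt n, size s = k & x * (\prod_(n <- s) n) <> 0].
  elim: k => [|k [s [rs sk sx]]]; first by exists [::]; rewrite big_nil mulr1.
  apply: contrapT => nex'; apply: nex; exists (\prod_(n <- s) n); split=> // n rn.
  apply: contrapT => nx; apply: nex'; exists (rcons s n).
  rewrite -cats1 big_cat big_seq1 mulrA /= size_cat sk addn1; split=> // u.
  by rewrite mem_cat inE => /orP[/rs//|/eqP->].
have [s [rs sm]] := grow m; apply.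
by rewrite (nil s rs sm) mulr0.
Qed.

(** In a simple submodule the elements killed by N form a nonzero submodule, hence everything. *)
Lemma left_socle_annihilated x n : left_socle A x -> radical_elt n -> n * x = 0.
Proof.
move=> [s sS ->] rn; rewrite mulr_sumr big_seq big1// => y /sS[S [subS _ minS] Sy].
pose T := [set u : A^o | S u /\ forall n, radical_elt n -> n * (u : A) = 0]%classic.
have subT : submodule T.
  split; first by split; [exact: subS.1 | move=> k _; rewrite mulr0].
  move=> k u w [Su u0] [Sw w0]; split; first exact: subS.2.
  move=> k' rk'; rewrite [LHS]mulrDr w0// addr0 mulrA u0//.
  exact: radical_eltMr.
have TS : (T `<=` S)%classic by move=> u [].
have [T0|TE] := minS T subT TS; last by move: Sy; rewrite -TE => -[_]; apply.
apply: contrapT => ny0.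
have y0 : y <> 0 by move=> e; apply: ny0; rewrite e mulr0.
have [u [uy0 uy]] := left_multiple_annihilated_by_radical y0.
suff : T (u * y) by rewrite T0.
split=> //; have := subS.2 u y 0 Sy subS.1; by rewrite addr0.
Qed.

Lemma right_socle_annihilated x n : right_socle A x -> radical_elt n -> x * n = 0.
Proof.
move=> [s sS ->] rn; rewrite big_seq.
apply: (big_ind (fun u : (A^c)^o => (u : A) * n = 0)) => [|u w u0 w0|].
- exact: (mul0r n).
- by rewrite [LHS](mulrDl (u : A) w n) u0 w0 addr0.
move=> y /sS[S [subS _ minS] Sy].
pose T := [set u : (A^c)^o | S u /\ forall n, radical_elt n -> (u : A) * n = 0]%classic.
have subT : submodule T.
  split; first by split; [exact: subS.1 | move=> k _; exact: (mul0r (k : A))].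
  move=> k u w [Su u0] [Sw w0]; split; first exact: subS.2.
  move=> k' rk'; rewrite [LHS](mulrDl ((u : A) * k) w k') w0// addr0 -mulrA u0//.
  exact: radical_eltMl.
have TS : (T `<=` S)%classic by move=> u [].
have [T0|TE] := minS T subT TS; last by move: Sy; rewrite -TE => -[_]; apply.
apply: contrapT => ny0.
have y0 : (y : A) <> 0 by move=> e; apply: ny0; rewrite e; exact: mul0r.
have [u [uy0 uy]] := right_multiple_annihilated_by_radical y0.
suff : T ((y : A) * u) by rewrite T0.
split=> //; have := subS.2 u y 0 Sy subS.1; by rewrite addr0.
Qed.

(** The kernel of the character [vertex_coef v] is a maximal left ideal. *)
Lemma jacobson_radical_radical_elt x : jacobson_radical A x -> radical_elt x.
Proof.
move=> Jx v; apply: (Jx [set u : A^o | vertex_coef v u = 0]%classic); split.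
- split; first exact: vertex_coef0.
  by move=> k u w /= u0 w0; rewrite vertex_coefD vertex_coefM u0 w0 mulr0 addr0.
- move=> /seteqP[_ /(_ (1 : A) Logic.I)] /=.
  by apply/eqP; rewrite vertex_coef1 oner_eq0.
- move=> N subN leN.
  have [le|/existsNP[y /not_implyP[Ny /= y0]]] :=
      pselect (forall y : A, N y -> vertex_coef v y = 0).
    by left; apply/seteqP; split.
  right; apply/seteqP; split=> // u _.
  have N1 : N (1 : A).
    have k0 : vertex_coef v y != 0 by exact/eqP.
    (* Chosen so that [1 - k * y] has coefficient 0 at [v]. *)
    pose k : A := (vertex_coef v y)^-1 *: 1.
    have <- : k * y + (1 - k * y) = 1 by rewrite addrC subrK.
    apply: (subN.2 k y _ Ny); rewrite /k -scalerAl mul1r.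
    apply: leN => /=; rewrite vertex_coefD vertex_coef1 -scaleN1r !vertex_coefZ.
    by rewrite mulVf// mulr1 subrr.
  by have := subN.2 u 1 0 N1 subN.1; rewrite addr0 -[X in N X]/(u * 1) mulr1.
Qed.

Lemma mul_vtx_radical x w : radical_elt x -> exists F : arrow Q -> A,
  x * vtx w = \sum_(a | target a == w) F a * arr a.
Proof.
move=> rx; have [F xE] := vtx_arr_decomposition_right x; exists F.
rewrite {1}xE big1 => [|v _]; last by rewrite rx scale0r.
rewrite add0r mulr_suml [RHS]big_mkcond; apply: eq_bigr => a _.
by rewrite -mulrA arr_vtx eq_sym; case: eqP; rewrite ?mulr0.
Qed.

Lemma vtx_mul x w : exists F : arrow Q -> A,
  vtx w * x = vertex_coef w x *: vtx w + \sum_(a | source a == w) arr a * F a.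
Proof.
have [F xE] := vtx_arr_decomposition_left x; exists F.
rewrite {1}xE mulrDr !mulr_sumr; congr (_ + _).
  rewrite (bigD1 w)//= -scalerAr vtxM eqxx big1 ?addr0// => v /negPf vw.
  by rewrite -scalerAr vtxM eq_sym vw scaler0.
rewrite [RHS]big_mkcond; apply: eq_bigr => a _.
by rewrite mulrA vtx_arr eq_sym; case: eqP; rewrite ?mul0r.
Qed.

(* Modulo the radical, [x] is the combination of the [vtx v] with coefficients *)
(* [vertex_coef v x].                                                          *)
Lemma mul_annihilated_left x z v : (forall n, radical_elt n -> n * z = 0) ->
  vtx v * z = z -> x * z = vertex_coef v x *: z.
Proof.
move=> nz vz; rewrite -{1}vz.
have -> : x * (vtx v * z) = (x * vtx v - vertex_coef v x *: vtx v) * z + vertex_coef v x *: z.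
  by rewrite mulrBl -scalerAl vz -mulrA vz subrK.
rewrite nz ?add0r// => w.
rewrite -scaleN1r vertex_coefD vertex_coefM !vertex_coefZ vertex_coef_vtx.
by case: eqP => [->|_]; rewrite ?mulr1 ?mulr0 ?mulN1r ?subrr ?oppr0 ?addr0.
Qed.

Lemma mul_annihilated_right x z v : (forall n, radical_elt n -> z * n = 0) ->
  z * vtx v = z -> z * x = vertex_coef v x *: z.
Proof.
move=> zn zv; rewrite -{1}zv.
have -> : z * vtx v * x = z * (vtx v * x - vertex_coef v x *: vtx v) + vertex_coef v x *: z.
  by rewrite mulrBr -scalerAr zv mulrA zv subrK.
rewrite zn ?add0r// => w.
rewrite -scaleN1r vertex_coefD vertex_coefM !vertex_coefZ vertex_coef_vtx.
by case: eqP => [->|_]; rewrite ?mul1r ?mul0r ?mulr0 ?mulN1r ?mulr1 ?subrr ?oppr0 ?addr0.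
Qed.

(** * Consequences of self-injectivity *)

Section SelfInjective.
Hypothesis injA : self_injective A.

(* [l] maps to [v] when the simple module at [v] is the socle of the           *)
(* indecomposable projective at [l]; this Nakayama map is injective, hence     *)
(* onto.                                                                       *)
Lemma vtx_annihilated_left v : exists z,
  [/\ z <> 0, vtx v * z = z & forall n, radical_elt n -> n * z = 0].
Proof.
(* The pair consists of a vertex and a nonzero socle element of A e_l cut down to that vertex on the
   left. *)
have top l : exists p : vertex Q * A, [/\ p.2 <> 0, vtx p.1 * p.2 = p.2,
    p.2 * vtx l = p.2 & forall n, radical_elt n -> n * p.2 = 0].
  have vl0 : vtx l <> 0.
    move=> /(congr1 (vertex_coef l)) /eqP.
    by rewrite vertex_coef_vtx eqxx vertex_coef0 oner_eq0.
  have [y [yl ny]] := left_multiple_annihilated_by_radical vl0.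
  have [k kyl] : exists k, vtx k * (y * vtx l) <> 0.
    apply: contrapT => nex; apply: yl; rewrite -[LHS]mul1r -sum_vtx mulr_suml.
    by apply: big1 => k _; apply: contrapT => kyl; apply: nex; exists k.
  exists (k, vtx k * (y * vtx l)); split=> //=.
  - by rewrite mulrA vtxM eqxx.
  - by rewrite -!mulrA vtxM eqxx.
  - by move=> n rn; rewrite mulrA ny//; exact: radical_eltMr.
have [nu nuP] := choice top.
pose soc l := (nu l).2.
(* Any [x] acts on both elements by its coefficient at the common vertex, so their left annihilators
   agree. *)
have transfer l l' : (nu l).1 = (nu l').1 -> exists y, soc l' = soc l * (vtx l * y * vtx l').
  move=> ll'; have [_ vz zl nz] := nuP l; have [_ vz' zl' nz'] := nuP l'.
  have z0 : soc l <> 0 by have [] := nuP l.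
  have [y ly] : exists y, soc l' = soc l * y.
    apply: self_injective_principal injA _ => x.
    rewrite (mul_annihilated_left x nz vz) => /eqP; rewrite scaler_eq0.
    move=> /orP[/eqP xv|/eqP//].
    by rewrite (mul_annihilated_left x nz' vz') -ll' xv scale0r.
  by exists y; rewrite -[LHS]zl' -/(soc l') ly !mulrA [soc l * vtx l]zl.
have nu_inj : injective (fun l => (nu l).1).
  move=> l l' ll'; apply: contrapT => /eqP/negPf ne.
  have [y ly] := transfer _ _ ll'; have [y' ly'] := transfer _ _ (esym ll').
  set u := vtx l * y * vtx l' in ly; set u' := vtx l' * y' * vtx l in ly'.
  (* As [l] and [l'] differ, [u * u'] is radical, hence nilpotent; yet it fixes the nonzero
     [soc l]. *)
  have ru : radical_elt (u * u').
    apply: radical_eltMr => w; rewrite !vertex_coefM !vertex_coef_vtx.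
    by case: (eqVneq w l) => [->|_]; rewrite ?ne ?mulr0 ?mul0r.
  have fix_u : soc l * (u * u') = soc l by rewrite mulrA -ly -ly'.
  have [m nil] := radical_elt_nilpotent.
  have : soc l * \prod_(x <- nseq m (u * u')) x = soc l.
    elim: (m) => [|k IHk] /=; first by rewrite big_nil mulr1.
    by rewrite big_cons mulrA fix_u.
  rewrite nil ?size_nseq//; last by move=> x /nseqP[->].
  by rewrite mulr0 => /esym; have [] := nuP l.
have /codomP[l vl] := injF_onto nu_inj v.
by exists (soc l); have [? ? ? ?] := nuP l; split; rewrite // vl.
Qed.

Lemma arr_right_annihilated_left a :
  (forall n, radical_elt n -> arr a * n = 0) ->
  forall n, radical_elt n -> n * arr a = 0.
Proof.
move=> an n rn; have [z [z0 vz nz]] := vtx_annihilated_left (source a).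
have [y zE] : exists y, z = arr a * y.
  apply: self_injective_principal injA _ => x /(congr1 (arrow_coef a)).
  rewrite arrow_coef0 arrow_coefM arrow_coef_arr eqxx vertex_coef_arr.
  rewrite mulr1 mulr0 addr0 => x0.
  by rewrite (mul_annihilated_left x nz vz) x0 scale0r.
(* Thus [z] is a nonzero scalar multiple of [arr a], which inherits N z = 0. *)
have ya : arr a * y = vertex_coef (target a) y *: arr a.
  by apply: mul_annihilated_right an _; rewrite arr_vtx eqxx.
have := nz n rn; rewrite zE ya -scalerAr => /eqP; rewrite scaler_eq0.
move=> /orP[/eqP y0|/eqP//]; case: z0.
by rewrite zE ya y0 scale0r.
Qed.

(** At a sink the left socle element would be a multiple of the vertex idempotent, which [arr c]
    does not kill. *)
Lemma arrow_target_not_sink c : exists d, source d = target c.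
Proof.
apply: contrapT => nex; have [z [z0 vz nz]] := vtx_annihilated_left (target c).
have [F] := vtx_mul z (target c).
rewrite vz big_pred0 => [|d]; last by apply/eqP => dc; apply: nex; exists d.
rewrite addr0 => zE; have := nz _ (radical_elt_arr c).
rewrite zE -scalerAr arr_vtx eqxx => /eqP; rewrite scaler_eq0.
move=> /orP[/eqP k0|/eqP]; last exact: arr_neq0.
by apply: z0; rewrite zE k0 scale0r.
Qed.

(** * Arrows killed from the left by the radical *)

Section SocleArrow.
Variable c : arrow Q.
Hypothesis nc : forall n, radical_elt n -> n * arr c = 0.

Let mulc x : x * arr c = vertex_coef (source c) x *: arr c.
Proof. by apply: mul_annihilated_left nc _; rewrite vtx_arr eqxx. Qed.

(* Otherwise the left ideal generated by [arr c] and [arr b] is a direct sum,  *)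
(* although the projective at the common target has a simple socle.            *)
Lemma socle_arrow_unique_target b : target b = target c -> b = c.
Proof.
move=> bc; apply: contrapT => /eqP/negPf ne.
(* The coefficient of [y] at the common target would then be 1 by comparison at [c] and 0 by
   comparison at [b]. *)
have [y cE] : exists y, arr c = (arr c + arr b) * y.
  apply: self_injective_principal injA _ => x /(congr1 (arrow_coef c)).
  rewrite arrow_coef0 arrow_coefM arrow_coefD !arrow_coef_arr eqxx eq_sym ne.
  rewrite vertex_coefD !vertex_coef_arr !addr0 mulr1 mulr0 addr0 => x0.
  by rewrite mulc x0 scale0r.
have := congr1 (arrow_coef c) cE; have := congr1 (arrow_coef b) cE.
rewrite !arrow_coefM !arrow_coefD !arrow_coef_arr !vertex_coefD !vertex_coef_arr.
rewrite !eqxx ne (eq_sym c) ne !addr0 !add0r !mul0r !add0r !mul1r bc => <- /eqP.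
by rewrite oner_eq0.
Qed.

(** A nonzero product has its left annihilator inside that of [arr c], so [arr c] would be a right
    multiple of it and lie in N^2. *)
Lemma socle_arrow_mul d : arr c * arr d = 0.
Proof.
apply: contrapT => cd0.
have [y cE] : exists y, arr c = arr c * arr d * y.
  apply: self_injective_principal injA _ => x.
  rewrite mulrA mulc -scalerAl => /eqP; rewrite scaler_eq0 => /orP[/eqP->|/eqP//].
  exact: scale0r.
have /eqP := congr1 (arrow_coef c) cE.
rewrite -mulrA arrow_coefM arrow_coef_arr eqxx vertex_coefM !vertex_coef_arr.
by rewrite !mul0r mulr0 addr0 oner_eq0.
Qed.

(** Radical elements ending at the target of [c] are left multiples of [arr c], the only arrow
    ending there. *)
Lemma socle_arrow_next d : source d = target c ->
  forall n, radical_elt n -> n * arr d = 0.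
Proof.
move=> dc n rn; have [F nE] := mul_vtx_radical (target c) rn.
have -> : arr d = vtx (target c) * arr d by rewrite vtx_arr dc eqxx.
rewrite mulrA nE mulr_suml big1// => a /eqP/socle_arrow_unique_target->.
by rewrite -mulrA socle_arrow_mul mulr0.
Qed.

End SocleArrow.

(** * The block spanned by the socle arrows *)

Hypothesis indA : indecomposable_algebra A.

Lemma socle_arrow_radical_square_zero c :
  (forall n, radical_elt n -> n * arr c = 0) ->
  forall x y, radical_elt x -> radical_elt y -> x * y = 0.
Proof.
move=> nc.
pose G := [set d : arrow Q | `[< forall n, radical_elt n -> n * arr d = 0 >]]%SET.
have GP d : reflect (forall n, radical_elt n -> n * arr d = 0) (d \in G).
  by rewrite inE; exact: asboolP.
(* Since socle arrows are determined by their targets, this choice of a successor permutes the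
   finite set [G]. *)
have [tau tauP] := choice arrow_target_not_sink.
have tauG d : d \in G -> tau d \in G.
  by move=> dG; apply/GP/(socle_arrow_next (GP _ dG)); exact: tauP.
have tau_inj : {in G &, injective tau}.
  move=> d d' dG d'G e; apply: socle_arrow_unique_target (GP _ d'G) _ _.
  by rewrite -tauP e tauP.
have tau_onto : [set tau d | d in G]%SET = G.
  apply/eqP; rewrite eqEcard card_in_imset// leqnn andbT.
  by apply/fintype.subsetP => _ /imsetP[d dG ->]; exact: tauG.
pose S := [set target d | d in G]%SET.
(* With [TG]: an arrow meets [S] at either end exactly when it lies in [G], which makes [e] below
   central. *)
have SG b : (source b \in S) = (b \in G).
  apply/imsetP/idP => [[d dG bd]|].
    exact/GP/(socle_arrow_next (GP _ dG)).
  by rewrite -{1}tau_onto => /imsetP[d dG ->]; exists d => //; exact: tauP.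
have TG b : (target b \in S) = (b \in G).
  apply/imsetP/idP => [[d dG bd]|bG]; last by exists b.
  by rewrite (socle_arrow_unique_target (GP _ dG) bd).
pose e := \sum_(v in S) vtx v.
have ev v : e * vtx v = if v \in S then vtx v else 0.
  rewrite mulr_suml big_mkcond (bigD1 v)//= vtxM eqxx big1 ?addr0// => w wv.
  by rewrite vtxM (negPf wv) if_same.
have ve v : vtx v * e = if v \in S then vtx v else 0.
  rewrite mulr_sumr big_mkcond (bigD1 v)//= vtxM eqxx big1 ?addr0// => w wv.
  by rewrite vtxM eq_sym (negPf wv) if_same.
have ea b : e * arr b = if b \in G then arr b else 0.
  have -> : arr b = vtx (source b) * arr b by rewrite vtx_arr eqxx.
  by rewrite mulrA ev SG; case: ifP; rewrite // mul0r.
have ae b : arr b * e = if b \in G then arr b else 0.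
  have -> : arr b = arr b * vtx (target b) by rewrite arr_vtx eqxx.
  by rewrite -mulrA ve TG; case: ifP; rewrite // mulr0.
have ce x : x * e = e * x.
  have [f <-] := quotient_map_surj x.
  elim/path_algebra_ind_left: f => [k f IHf|f g IHf IHg|v|a f IHf].
  - by rewrite linearZ /= -scalerAl -scalerAr IHf.
  - by rewrite raddfD /= mulrDl mulrDr IHf IHg.
  - by rewrite -[pi _]/(vtx v) ev ve.
  - by rewrite rmorphM /= -mulrA IHf !mulrA -[pi _]/(arr a) ae ea.
have ee : e * e = e.
  by rewrite {2}/e mulr_sumr; apply: eq_bigr => v vS; rewrite ev vS.
have coef_e v : vertex_coef v e = (v \in S)%:R.
  have := vertex_coefM v (e : A) (vtx v); rewrite ev vertex_coef_vtx eqxx mulr1 => <-.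
  by case: ifP; rewrite ?vertex_coef_vtx ?eqxx ?vertex_coef0.
have [e0|e1] := indecomposable_central_idempotent indA ce ee.
  have /eqP := coef_e (target c).
  by rewrite TG (introT (GP c) nc) e0 vertex_coef0 eq_sym oner_eq0.
have allG b : b \in G.
  have /eqP := coef_e (source b).
  by rewrite SG e1 vertex_coef1; case: (b \in G) => //; rewrite oner_eq0.
move=> x y rx ry; have [F ->] := vtx_arr_decomposition_right y.
rewrite big1 ?add0r => [|v _]; last by rewrite ry scale0r.
rewrite mulr_sumr big1// => b _.
by rewrite mulrA (GP _ (allG b))//; exact: radical_eltMr.
Qed.

End SelfInjective.

End BoundQuiverAlgebra.

Theorem proposition3p2 (K : fieldType) (Q : quiver)
    (I : proper_twosided_ideal (path_algebra K Q)) :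
  let A := bound_quiver_algebra I in
  admissible I ->
  finite_dimensional A ->
  indecomposable_algebra A ->
  self_injective A ->
  ideal_exp (jacobson_radical A) 2 <> [set (0 : A)]%R%classic ->
  arrow_free_socle I.
Proof.
move=> A admI _ indA injA J2.
have contra a : ~ forall n, radical_elt n -> (n * arr I a = 0)%R.
  move=> na; apply: J2; apply/seteqP; split=> /= [x [s sJ ->]|_ ->]; last first.
    by exists [::]; rewrite ?big_nil.
  rewrite big_seq big1// => p /sJ[/(jacobson_radical_radical_elt admI) r1].
  move=> [t tJ ->]; apply: (socle_arrow_radical_square_zero admI injA indA na r1).
  (* [p.2] is a sum of products with left factors in the Jacobson radical, so it is again
     radical. *)
  move=> v; rewrite big_seq; apply: (big_ind (fun u => vertex_coef v u = 0%R)).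
  - exact: vertex_coef0.
  - by move=> u w u0 w0; rewrite vertex_coefD// u0 w0 addr0.
  - move=> q /tJ[/(jacobson_radical_radical_elt admI) r _].
    exact: (radical_eltMr admI).
move=> a; split=> [socl|socr]; apply: (contra a).
  by move=> n rn; exact: left_socle_annihilated socl rn.
apply: arr_right_annihilated_left => // n rn.
exact: right_socle_annihilated socr rn.
Qed.
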